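(* Let $r,n\ge2$, $\pi=A_1\cdots A_n\in\mathbb{S}_{2rn}$ with $A_j=(2r(j-1)+1\ \cdots\ 2rj)$, $\mathcal{C}$ its conjugacy class, $\mu\in\{\epsilon,\mathrm{sgn}\}$, and let $\rho$ be a one-dimensional representation of $\mathbb{S}_{2rn}^\pi$ with $\rho(\pi)=-1$. (a) If $r$ is odd and $\rho=\chi_{r,\dots,r}\otimes\mu$, then the braiding of $M(\mathcal{C},\rho)$ is negative. (b) If $r$ is even and $\rho=\chi_{c,\dots,c}\otimes\mu$ with $c\in\{r/2,\,r,\,3r/2\}$, then the braiding of $M(\mathcal{C},\rho)$ is negative.
   Context: Permutations are composed right to left. For a finite group $G$, a conjugacy class $\mathcal{C}$, a fixed $s\in\mathcal{C}$ with centralizer $G^s$ and an irreducible representation $(\rho,V)$ of $G^s$, $M(\mathcal{C},\rho)$ is the irreducible Yetter–Drinfeld module over $\mathbb{C}G$: enumerate $\mathcal{C}=\{t_1=s,\dots,t_M\}$, choose $g_i\in G$ with $g_isg_i^{-1}=t_i$; $M(\mathcal{C},\rho)=\bigoplus_i g_i\otimes V$ with grading $\deg(g_i\otimes v)=t_i$, action $g\cdot(g_i\otimes v)=g_j\otimes\rho(\gamma)v$ where $gg_i=g_j\gamma$, $\gamma\in G^s$, and braiding $c((g_i\otimes v)\otimes(g_j\otimes w))=(g_h\otimes\rho(\gamma)w)\otimes(g_i\otimes v)$ where $t_ig_j=g_h\gamma$. When $\rho$ is one-dimensional, the braiding is called negative if for all $i,j$ with $t_it_j=t_jt_i$, setting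 $q_{ij}:=\rho(g_j^{-1}t_ig_j)$, one has $q_{ii}=-1$ and $q_{ij}q_{ji}=1$. Let $B_i$ ($1\le i\le n-1$) be the involution exchanging $2r(i-1)+m\leftrightarrow 2ri+m$ for $1\le m\le 2r$. Then $\mathbb{S}_{2rn}^\pi=\langle A_1,\dots,A_n\rangle\rtimes\langle B_1,\dots,B_{n-1}\rangle\cong\mathbb{Z}_{2r}^n\rtimes\mathbb{S}_n$, $B_i\mapsto(i\ i+1)$. With $\omega=e^{i\pi/r}$, $\chi_{c,\dots,c}\otimes\mu$ is the one-dimensional representation with $A_j\mapsto\omega^c$ for all $j$ and $B_i\mapsto\mu((i\ i+1))$, where $\epsilon,\mathrm{sgn}$ are the trivial and sign characters of $\mathbb{S}_n$. *)

(* Defs.v *)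
From HB Require Import structures.
From mathcomp Require Import all_boot all_order all_algebra all_fingroup all_solvable all_field all_character.
From mathcomp Require Import zify.
Import GRing.Theory Num.Theory.

(* Conventions.  The points 1..2rn of the paper are the elements 0..2rn-1 of
   'I_(r.*2 * n) (paper point m is m-1 here).  Block j (0-based, j < n) is
   {2rj, ..., 2rj+2r-1}, i.e. the support of the paper's A_{j+1}.          *)

Definition cycA_nat (d j x : nat) : nat :=
  if x %/ d == j then j * d + (x %% d).+1 %% d else x.

Definition swapB_nat (d i x : nat) : nat :=
  if x %/ d == i then x + d else if x %/ d == i.+1 then x - d else x.

(* pi = A_1 ... A_n : every point moves cyclically inside its own block *)
Definition pi_nat (d x : nat) : nat := cycA_nat d (x %/ d) x.

Lemma blkE d x j : 0 < d -> (x %/ d == j) = (j * d <= x < j * d + d).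
Proof.
move=> dp; apply/eqP/andP.
  move=> <-; split; first by rewrite leq_trunc_div.
  by rewrite -mulSnr -ltn_divLR // ltnSn.
case=> h1 h2; apply/eqP; rewrite eqn_leq -ltnS ltn_divLR // mulSnr h2 /=.
by rewrite leq_divRL.
Qed.

Lemma modE d x : 0 < d -> x = x %/ d * d + x %% d /\ x %% d < d.
Proof. by move=> dp; rewrite -divn_eq ltn_pmod. Qed.

Lemma modS d m : m < d -> m.+1 %% d = if m.+1 == d then 0 else m.+1.
Proof.
move=> md; case: eqP => [->|ne]; first by rewrite modnn.
by rewrite modn_small //; lia.
Qed.

Lemma cycA_nat_inj d j : 0 < d -> injective (cycA_nat d j).
Proof.
move=> dp x y; rewrite /cycA_nat.
have [ex mx] := modE _ x dp; have [ey my] := modE _ y dp.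
rewrite (modS _ _ mx) (modS _ _ my).
have bx := blkE _ x j dp; have By := blkE _ y j dp.
case: (x %/ d == j) / eqP bx => qx bx; case: (y %/ d == j) / eqP By => qy By;
 rewrite ?qx ?qy in ex ey *;
 case: ((x %% d).+1 == d) / eqP => ?; case: ((y %% d).+1 == d) / eqP => ?; lia.
Qed.

Lemma cycA_nat_bound d j x n : 0 < d -> x < d * n -> cycA_nat d j x < d * n.
Proof.
move=> dp xN; rewrite /cycA_nat.
have [ex mx] := modE _ x dp.
have bx := blkE _ x j dp.
have Hq : x %/ d < n by rewrite ltn_divLR // mulnC.
case: (x %/ d == j) / eqP bx => qx bx //.
rewrite (modS _ _ mx); rewrite -qx.
have : (x %/ d).+1 * d <= d * n by rewrite mulnC leq_mul2l Hq orbT.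
rewrite mulSn; case: ((x %% d).+1 == d) / eqP => ? H; lia.
Qed.

Lemma pi_nat_inj d : 0 < d -> injective (pi_nat d).
Proof.
move=> dp x y; rewrite /pi_nat => E.
have Hx := blkE _ (cycA_nat d (x %/ d) x) (x %/ d) dp.
have Hy := blkE _ (cycA_nat d (y %/ d) y) (y %/ d) dp.
have [ex mx] := modE _ x dp; have [ey my] := modE _ y dp.
have fx : cycA_nat d (x %/ d) x %/ d == x %/ d.
  rewrite Hx /cycA_nat eqxx (modS _ _ mx); case: ((x %% d).+1 == d) / eqP => ?; lia.
have fy : cycA_nat d (y %/ d) y %/ d == y %/ d.
  rewrite Hy /cycA_nat eqxx (modS _ _ my); case: ((y %% d).+1 == d) / eqP => ?; lia.
have qe : x %/ d = y %/ d by rewrite -(eqP fx) -(eqP fy) E.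
by rewrite qe in E; apply: cycA_nat_inj E.
Qed.

Lemma pi_nat_bound d x n : 0 < d -> x < d * n -> pi_nat d x < d * n.
Proof. by move=> dp xN; apply: cycA_nat_bound. Qed.

Lemma swapB_nat_inj d i : 0 < d -> injective (swapB_nat d i).
Proof.
move=> dp x y; rewrite /swapB_nat.
have bx := blkE _ x i dp; have By := blkE _ y i dp.
have bx' := blkE _ x i.+1 dp; have By' := blkE _ y i.+1 dp.
rewrite mulSn in bx' By'.
case: (x %/ d == i) / eqP bx => qx bx; case: (y %/ d == i) / eqP By => qy By;
case: (x %/ d == i.+1) / eqP bx' => qx' bx'; case: (y %/ d == i.+1) / eqP By' => qy' By';
 lia.
Qed.

Lemma swapB_nat_bound d i x n : 0 < d -> i.+1 < n -> x < d * n ->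
  swapB_nat d i x < d * n.
Proof.
move=> dp iN xN; rewrite /swapB_nat.
have bx := blkE _ x i dp.
have : i.+2 * d <= d * n by rewrite mulnC leq_mul2l iN orbT.
rewrite !mulSn.
case: (x %/ d == i) / eqP bx => qx bx; [lia|].
by case: ifP => _; lia.
Qed.

Set Implicit Arguments. Unset Strict Implicit. Unset Printing Implicit Defensive.

Section Perms.
Variables r n : nat.
Local Notation d := (r.*2).
Local Notation N := (r.*2 * n).

Definition lift_fun (f : nat -> nat) (x : 'I_N) : 'I_N := insubd x (f x).

Lemma lift_fun_inj (f : nat -> nat) :
  injective f -> (forall x, x < N -> f x < N) -> injective (lift_fun f).
Proof.
move=> fi fb x y; rewrite /lift_fun => E; apply: val_inj; apply: fi.
by move: (congr1 val E); rewrite !val_insubd !fb.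
Qed.

Lemma dpos_or_empty (x : 'I_N) : 0 < d.
Proof. move: (ltn_ord x); move: (nat_of_ord x) => m. by case: (posnP r.*2) => [->|]. Qed.

Lemma cycA_inj j : injective (lift_fun (cycA_nat d j)).
Proof.
move=> x y; have dp := dpos_or_empty x; move: x y.
apply: lift_fun_inj; first exact: cycA_nat_inj.
by move=> x; apply: cycA_nat_bound.
Qed.

Lemma pi_inj : injective (lift_fun (pi_nat d)).
Proof.
move=> x y; have dp := dpos_or_empty x; move: x y.
apply: lift_fun_inj; first exact: pi_nat_inj.
by move=> x; apply: pi_nat_bound.
Qed.

Lemma swapB_inj i : injective (lift_fun (if i.+1 < n then swapB_nat d i else id)).
Proof.
move=> x y; have dp := dpos_or_empty x; move: x y.
case: ifP => iN; apply: lift_fun_inj => //.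
- exact: swapB_nat_inj.
- by move=> x; apply: swapB_nat_bound.
Qed.

(* A_{j+1} of the paper (j : nat, 0-based; meaningful for j < n) *)
Definition cycA (j : nat) : {perm 'I_N} := perm (@cycA_inj j).

(* B_{i+1} of the paper (i : nat, 0-based; meaningful for i < n-1,
   the identity otherwise) *)
Definition swapB (i : nat) : {perm 'I_N} := perm (@swapB_inj i).

Definition pi_perm : {perm 'I_N} := perm pi_inj.

End Perms.

(* MathComp multiplies permutations left to right ((p * q) x = q (p x)),
   whereas the paper composes right to left.  Translating the paper's
   formulas: the paper's  g s g^{-1}  is  s ^ g = g^-1 * s * g  here, and the
   paper's  g_j^{-1} t_i g_j  is  g_j * t_i * g_j^-1  here.  Since the
   braiding datum q_ij does not depend on the choice of the g_i (rho is
   one-dimensional), we require the condition for every choice. *)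
Definition negative_braiding (gT : finGroupType) (s : gT) (rho : gT -> algC)
  : Prop :=
  forall (t u g h : gT), t = (s ^ g)%g -> u = (s ^ h)%g -> commute t u ->
    (rho (g * t * g^-1)%g = -1)%R /\
    (* q_tu * q_ut = 1,  q_tu = rho(g_u^{-1} t g_u) in the paper's notation *)
    (rho (h * t * h^-1)%g * rho (g * u * g^-1)%g = 1)%R.

(* omega = e^{i pi / r}: the r-th root of -1 with minimal argument *)
Definition omega (r : nat) : algC := r.-root (-1)%R.

(* rho = chi_{c,...,c} (x) mu, where mu = eps if b = false, sgn if b = true:
   rho(A_j) = omega^c for all j, rho(B_i) = mu((i i+1)) = (-1)^b *)
Definition is_chi_mu (r n : nat) (rho : {perm 'I_(r.*2 * n)} -> algC)
  (c : nat) (b : bool) : Prop :=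
  (forall j, j < n -> rho (cycA r n j) = (omega r ^+ c)%R) /\
  (forall i, i.+1 < n -> rho (swapB r n i) = ((-1) ^+ b)%R).

(* Main.v *)
(** Put s = pi, d = 2r.  For t = s^g, u = s^h the two values of rho are rho(x)
    and rho(y) with x = s^k, y = s^(k^-1), k = g h^-1, and x, y centralize s.
    On an orbit O of <s, x>, which consists of m blocks, x^m acts as s^a for
    some a.  Writing z = rho(A_j), rho(x) is the product of the z^a over all
    orbits, times a sign that depends only on the number of orbits.  Since
    conjugation by k maps (s, y) to (x, s), rho(y) has the same sign and is
    the product of the z^c, where s^m acts as x^c on O.  Then m divides a and
    c, say a = m al and c = m be, and m al be = m mod d.  If e = 2 or e = 4
    divides d and z^e = 1, this congruence mod e implies m (al + be) = 2m mod e,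
    so z^(a + c) = z^(2m).  The numbers m add up to n, hence
    rho(x) rho(y) = z^(2n) = rho(pi)^2 = 1. *)

Require Import Defs.
From HB Require Import structures.
From mathcomp Require Import all_boot all_order all_algebra all_fingroup all_solvable all_field all_character.
Import GRing.Theory Num.Theory.

Set Implicit Arguments.
Unset Strict Implicit.
Unset Printing Implicit Defensive.

(** * Arithmetic modulo 2 and 4, and lengths of cycles *)

(** For odd [m], [a] and [b] are inverse units modulo [e]; units modulo 2 or 4 are their own
    inverses, so [a = b], and twice a unit is 2 modulo [e]. If [e = 4] and [m = 2], both factors are
    odd and their sum is even. The proof checks all residues. *)
Lemma mul_inverse_mod e m a b :
    e \in [:: 2; 4] -> m = m * (a * b) %[mod e] ->
  a * m + b * m = m * 2 %[mod e].
Proof.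
move=> e24; rewrite -(modnMmr m) -(modnMm a) -(modnMml m) modnMmr.
rewrite -(modnMml m 2) -modnDm -(modnMm a) -(modnMm b) modnDm.
have : [&& m %% e < e, a %% e < e & b %% e < e].
  by rewrite !ltn_pmod //; move: e24; rewrite !inE => /orP[]/eqP->.
move: e24; rewrite !inE => /orP[]/eqP->.
all: case: (m %% _) => [|[|[|[|?]]]] //; case: (a %% _) => [|[|[|[|?]]]] //.
all: by case: (b %% _) => [|[|[|[|?]]]].
Qed.

Lemma porbit_dvd (T : finType) (t : {perm T}) e p :
  (t ^+ e)%g p = p -> #|porbit t p| %| e.
Proof.
set m := #|_| => te; have m_gt0 : 0 < m by rewrite lt0n card_porbit_neq0.
have tm1 : (t ^+ m)%g p = p by rewrite permX iter_porbit.
have tm k : (t ^+ (k * m))%g p = p.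
  by elim: k => [|k IHk]; rewrite ?perm1 // mulSn expgD permM tm1.
move: te; rewrite (divn_eq e m) expgD permM tm permX => te.
rewrite dvdn_addr ?dvdn_mull // /dvdn modn_mod.
rewrite -(nth_uniq p _ _ (uniq_traject_porbit t p)) ?size_traject ?ltn_pmod //.
by rewrite !nth_traject ?ltn_pmod //= te.
Qed.

(** * Joint orbits of two permutations and their behaviour under conjugation *)

Section JointOrbits.

Variable T : finType.
Implicit Types (s x k : {perm T}) (p q : T).

Definition jorb s x p := orbit 'P (<[s]> <*> <[x]>)%g p.
Definition jorbs s x := jorb s x @: [set: T].

Lemma jorbC s x : jorb s x = jorb x s.
Proof. by rewrite /jorb joingC. Qed.

Lemma jorb_refl s x p : p \in jorb s x p.
Proof. exact: orbit_refl. Qed.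

(** Commutation makes the join of the two cyclic groups their product set. *)
Lemma jorbP s x p q : commute s x ->
  reflect (exists i j, q = (x ^+ j)%g ((s ^+ i)%g p)) (q \in jorb s x p).
Proof.
move=> sx; have cxs : (<[x]> \subset 'C(<[s]>))%g.
  by rewrite cent_cycle cycle_subG; apply/cent1P.
apply: (iffP orbitP) => [[g]|[i [j ->]]].
  rewrite cent_joinEr // => /mulsgP[_ _ /cycleP[i ->] /cycleP[j ->] ->] <-.
  by exists i, j; rewrite /= /aperm permM.
exists (s ^+ i * x ^+ j)%g; last by rewrite /= /aperm permM.
by rewrite cent_joinEr // mem_mulg ?mem_cycle.
Qed.

Lemma jorbs_partition s x : partition (jorbs s x) [set: T].
Proof.
by apply: orbit_partition; apply/actsP => g _ p; rewrite !inE.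
Qed.

Lemma jorbJ s x k p : commute s x ->
  jorb (s ^ k) (x ^ k) (k p) = [set k q | q in jorb s x p].
Proof.
move=> sx; have sxk : commute (s ^ k)%g (x ^ k)%g.
  by rewrite /commute -!conjMg sx.
apply/setP => q; apply/(jorbP _ _ sxk)/imsetP => [[i [j ->]]|[q']]; last first.
  by move=> /(jorbP _ _ sx)[i [j ->]] ->; exists i, j; rewrite -!conjXg !permJ.
exists ((x ^+ j)%g ((s ^+ i)%g p)); last by rewrite -!conjXg !permJ.
by apply/jorbP => //; exists i, j.
Qed.

Lemma jorbsJ s x k : commute s x ->
  jorbs (s ^ k) (x ^ k) = [set [set k q | q in O] | O : {set T} in jorbs s x].
Proof.
move=> sx; apply/setP => O; apply/imsetP/imsetP.
- case=> p _ ->.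
  exists (jorb s x ((k^-1)%g p)); first by rewrite imset_f ?inE.
  by rewrite -jorbJ // permKV.
- by case=> _ /imsetP[p _ ->] ->; exists (k p); rewrite ?inE ?jorbJ.
Qed.

End JointOrbits.

(** * Block and offset coordinates, in which [s] shifts the offset by one *)

Section BlockPermutations.

Variables r n : nat.
Hypothesis r_gt0 : 0 < r.
Local Notation d := r.*2.
Local Notation N := (r.*2 * n).
Local Notation s := (pi_perm r n).
Implicit Types p : 'I_N.

Lemma d_gt0 : 0 < d. Proof. by rewrite double_gt0. Qed.

Lemma blk_subproof (p : 'I_N) : p %/ d < n.
Proof. by rewrite ltn_divLR ?d_gt0 // [n * _]mulnC. Qed.
Definition blk (p : 'I_N) : 'I_n := Ordinal (blk_subproof p).

Lemma base_subproof (j : 'I_n) : j * d < N.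
Proof. by rewrite mulnC ltn_pmul2l ?d_gt0. Qed.
Definition base (j : 'I_n) : 'I_N := Ordinal (base_subproof j).

Lemma blk_base j : blk (base j) = j.
Proof. by apply: val_inj; rewrite /= mulnK ?d_gt0. Qed.

Lemma val_pi p : val (s p) = p %/ d * d + (p %% d).+1 %% d.
Proof.
rewrite permE /lift_fun val_insubd pi_nat_bound ?d_gt0 //.
by rewrite /pi_nat /cycA_nat eqxx.
Qed.

Lemma val_piX i p : val ((s ^+ i)%g p) = p %/ d * d + (p %% d + i) %% d.
Proof.
elim: i => [|i IHi]; first by rewrite perm1 addn0 modn_mod -divn_eq.
rewrite expgSr permM val_pi IHi divnMDl ?d_gt0 // modnMDl modn_mod.
rewrite [X in (_ + X) * _]divn_small ?ltn_pmod ?d_gt0 // addn0.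
by rewrite -addn1 modnDml -addnA addn1.
Qed.

Lemma blk_piX i p : blk ((s ^+ i)%g p) = blk p.
Proof.
apply: val_inj; rewrite /= val_piX divnMDl ?d_gt0 //.
by rewrite [X in _ + X]divn_small ?addn0 // ltn_pmod ?d_gt0.
Qed.

(** All cycles of [s] have the same length [d], so the criterion is the same at every point. *)
Lemma eq_piX i j p : ((s ^+ i)%g p == (s ^+ j)%g p) = (i == j %[mod d]).
Proof. by rewrite -val_eqE /= !val_piX eqn_add2l eqn_modDl. Qed.

Lemma pi_baseE p : p = (s ^+ (p %% d))%g (base (blk p)).
Proof.
by apply: val_inj; rewrite val_piX /= mulnK ?d_gt0 // modnMl modn_mod -divn_eq.
Qed.

Lemma eq_blkP p p' : reflect (exists i, p' = (s ^+ i)%g p) (blk p == blk p').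
Proof.
apply: (iffP eqP) => [eb|[i ->]]; last by rewrite blk_piX.
have Hd : p %% d <= d by rewrite ltnW // ltn_pmod ?d_gt0.
(* Complete the turn from [p] to the base of its block, then climb to the offset of [p']. *)
exists (d - p %% d + p' %% d).
rewrite {1}(pi_baseE p') {2}(pi_baseE p) -permM -expgD eb.
by apply/eqP; rewrite eq_piX addnA subnKC // modnDl.
Qed.

(** * The centralizer of [s]: powers of the [A_j] times lifted block permutations *)

Lemma cent_piX (x : {perm 'I_N}) i p :
  x \in 'C[s]%g -> x ((s ^+ i)%g p) = (s ^+ i)%g (x p).
Proof. by move=> /cent1P/(commuteX i) c; rewrite -!permM c. Qed.

Lemma cycAE j p : cycA r n j p = if blk p == j :> nat then s p else p.
Proof.
apply: val_inj; rewrite permE /lift_fun val_insubd cycA_nat_bound ?d_gt0 //.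
by rewrite /cycA_nat; case: ifP => //= /eqP <-; rewrite val_pi.
Qed.

Lemma cycAXE j i p :
  (cycA r n j ^+ i)%g p = if blk p == j :> nat then (s ^+ i)%g p else p.
Proof.
elim: i => [|i IHi]; first by rewrite !perm1 if_same.
rewrite expgSr permM IHi; case: ifP => bj; rewrite cycAE ?blk_piX bj //.
by rewrite expgSr permM.
Qed.

Lemma cent1_pi (x : {perm 'I_N}) :
  (forall p, x (s p) = s (x p)) -> x \in 'C[s]%g.
Proof. by move=> xs; apply/cent1P/permP => p; rewrite !permM xs. Qed.

Lemma cycA_cent j : cycA r n j \in 'C[s]%g.
Proof. by apply: cent1_pi => p; rewrite !cycAE (blk_piX 1); case: ifP. Qed.

(** Moves whole blocks and keeps offsets, which embeds ['S_n] in the centralizer of [s]. *)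
Definition liftB_fun (t : 'S_n) p := (s ^+ (p %% d))%g (base (t (blk p))).

Lemma liftB_inj t : injective (liftB_fun t).
Proof.
move=> p p' e; have := congr1 blk e; rewrite !blk_piX !blk_base => /perm_inj eb.
rewrite (pi_baseE p) (pi_baseE p') eb; apply/eqP; rewrite eq_piX.
by move/eqP: e; rewrite /liftB_fun eb eq_piX.
Qed.

Definition liftB t : {perm 'I_N} := perm (@liftB_inj t).

Lemma liftBE t i j : liftB t ((s ^+ i)%g (base j)) = (s ^+ i)%g (base (t j)).
Proof.
rewrite permE /liftB_fun blk_piX blk_base val_piX modnMDl modn_mod.
by apply/eqP; rewrite eq_piX modn_mod /= modnMl.
Qed.

Lemma liftB_cent t : liftB t \in 'C[s]%g.
Proof.
apply: cent1_pi => p; rewrite (pi_baseE p).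
by rewrite -[s _]permM -[in LHS]expgSr !liftBE expgSr permM.
Qed.

Lemma liftB1 : liftB 1%g = 1%g.
Proof.
by apply/permP => p; rewrite {1}(pi_baseE p) liftBE !perm1 -pi_baseE.
Qed.

Lemma liftBM : {morph liftB : t u / (t * u)%g}.
Proof.
by move=> t u; apply/permP => p; rewrite (pi_baseE p) permM !liftBE permM.
Qed.

Lemma liftBV t : liftB t^-1 = (liftB t)^-1%g.
Proof. by apply/esym/eqP; rewrite eq_invg_mul -liftBM mulgV liftB1. Qed.

Lemma liftBJ t u : liftB (t ^ u) = (liftB t ^ liftB u)%g.
Proof. by rewrite /conjg !liftBM liftBV. Qed.

Lemma liftB_swap (i j : 'I_n) : val j = i.+1 -> liftB (tperm i j) = swapB r n i.
Proof.
move=> ij; apply/permP => p; apply: val_inj.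
have i1n : i.+1 < n by rewrite -ij ltn_ord.
rewrite [in RHS]permE /lift_fun val_insubd i1n swapB_nat_bound ?d_gt0 //.
rewrite permE /liftB_fun val_piX /= mulnK ?d_gt0 // modnMl modn_mod /swapB_nat.
have -> : (p %/ d == i) = (blk p == i) by [].
have -> : (p %/ d == i.+1) = (blk p == j) by rewrite -val_eqE /= ij.
have pd := divn_eq p d.
case: tpermP => [e|e|/eqP/negPf-> /eqP/negPf->]; last by rewrite -divn_eq.
  have pi : p %/ d = i by rewrite -e.
  by rewrite e eqxx [in RHS]pd pi ij mulSn -addnA addnC.
have pj : p %/ d = i.+1 by rewrite -ij -e.
rewrite e eqxx -val_eqE ij /= (gtn_eqF (ltnSn i)) [in RHS]pd pj mulSn.
by rewrite -addnA addKn.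
Qed.

(** Blocks are the cycles of [s], and a permutation commuting with [s] permutes these cycles. *)
Lemma cent_blk (x : {perm 'I_N}) : x \in 'C[s]%g ->
  exists sg : 'S_n, forall p, blk (x p) = sg (blk p).
Proof.
move=> xC; have blkx p p' : blk p = blk p' -> blk (x p) = blk (x p').
  by move=> /eqP/eq_blkP[i ->]; rewrite cent_piX // blk_piX.
have inj : injective (fun j => blk (x (base j))).
  move=> j j' /eqP/eq_blkP[i]; rewrite -cent_piX // => /perm_inj e.
  by rewrite -(blk_base j') e blk_piX blk_base.
by exists (perm inj) => p; rewrite permE; apply: blkx; rewrite blk_base.
Qed.

(** The supports are disjoint, so only the factor of the block of [p] moves [p]. *)
Lemma prod_cycAE (a : 'I_n -> nat) p :
  (\prod_(j < n) cycA r n j ^+ a j)%g p = (s ^+ a (blk p))%g p.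
Proof.
have E (l : seq 'I_n) : uniq l -> (\prod_(j <- l) cycA r n j ^+ a j)%g p =
    if blk p \in l then (s ^+ a (blk p))%g p else p.
  elim/last_ind: l => [|l j IHl]; first by rewrite big_nil perm1.
  rewrite rcons_uniq mem_rcons inE => /andP[jl /IHl{}IHl].
  rewrite big_rcons permM IHl cycAXE.
  have E q : (blk q == j :> nat) = (blk q == j) by [].
  rewrite E (fun_if blk) blk_piX if_same.
  have [->|] := eqVneq (blk p) j; last by case: ifP.
  by rewrite orTb (negPf jl).
by rewrite E ?mem_index_enum // /index_enum -enumT enum_uniq.
Qed.

(** Commuting with [s], [x] is determined by its values at the base points. *)
Lemma cent_decomp (x : {perm 'I_N}) (sg : 'S_n) (a : 'I_n -> nat) :
    x \in 'C[s]%g ->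
    (forall j, x (base j) = (s ^+ a j)%g (base (sg j))) ->
  x = ((\prod_(j < n) cycA r n j ^+ a j) * liftB sg)%g.
Proof.
move=> xC xE; apply/permP => p.
rewrite permM prod_cycAE {1 3}(pi_baseE p) cent_piX // xE.
by rewrite -[(s ^+ _)%g _ in RHS]permM -expgD liftBE addnC expgD permM.
Qed.

Lemma card_blk_preim (C : {set 'I_n}) : #|blk @^-1: C| = #|C| * d.
Proof.
pose f (c : 'I_n * 'I_d) := (s ^+ c.2)%g (base c.1).
have f_inj : injective f.
  move=> [j i] [j' i'] e; have := congr1 blk e.
  rewrite !blk_piX !blk_base /= => ej; move/eqP: e; rewrite /f /= ej eq_piX.
  by rewrite !modn_small // => /eqP/val_inj->.
rewrite -[d in RHS]card_ord -cardsT -cardsX -(card_imset _ f_inj).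
apply: eq_card => p; rewrite inE; apply/idP/imsetP => [pC|[[j i]]].
  have pd : p %% d < d by rewrite ltn_pmod ?d_gt0.
  by exists (blk p, Ordinal pd); rewrite ?inE ?pC // {1}(pi_baseE p).
by rewrite !inE andbT /= => jC ->; rewrite blk_piX blk_base.
Qed.

(** * Joint orbits of [s] and a centralizing [x], and return exponents *)

Section Centralizer.

Variables (x : {perm 'I_N}) (sg : 'S_n).
Hypothesis xC : x \in 'C[s]%g.
Hypothesis blkx : forall p, blk (x p) = sg (blk p).

Let sx : commute s x. Proof. exact/esym/cent1P. Qed.

Lemma blk_centX i p : blk ((x ^+ i)%g p) = (sg ^+ i)%g (blk p).
Proof.
by elim: i => [|i IHi]; rewrite ?perm1 // !expgSr !permM blkx IHi.
Qed.

(** Powers of [s] sweep out each block, while [x] moves blocks along the cycles of [sg]. *)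
Lemma jorb_preim p : jorb s x p = blk @^-1: porbit sg (blk p).
Proof.
apply/setP => q; rewrite inE.
apply/(jorbP _ _ sx)/porbitP => [[i [j ->]]|[j e]].
  by exists j; rewrite blk_centX blk_piX.
have /eqP/eq_blkP[i ->] : blk ((x ^+ j)%g p) = blk q by rewrite blk_centX.
by exists i, j; rewrite cent_piX // groupX.
Qed.

Lemma card_jorb p : #|jorb s x p| = #|porbit sg (blk p)| * d.
Proof. by rewrite jorb_preim card_blk_preim. Qed.

Lemma jorbsE : jorbs s x = [set blk @^-1: C | C : {set 'I_n} in porbits sg].
Proof.
apply/setP => O; apply/imsetP/imsetP => [[p _ ->]|[_ /imsetP[j _ ->] ->]].
  by exists (porbit sg (blk p)); rewrite ?jorb_preim // imset_f.
by exists (base j); rewrite ?inE // jorb_preim blk_base.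
Qed.

Lemma blk_preim_inj : injective (fun C : {set 'I_n} => blk @^-1: C).
Proof.
move=> C D /setP e; apply/setP => j.
by have := e (base j); rewrite !inE blk_base.
Qed.

Lemma return_dvd p e f :
  (x ^+ e)%g p = (s ^+ f)%g p -> #|jorb s x p| %/ d %| e.
Proof.
move=> /(congr1 blk); rewrite blk_centX blk_piX card_jorb mulnK ?d_gt0 //.
exact: porbit_dvd.
Qed.

Lemma return_exists : exists a : {set 'I_N} -> nat, forall p,
  (x ^+ (#|jorb s x p| %/ d))%g p = (s ^+ a (jorb s x p))%g p.
Proof.
suff /fin_all_exists[a aP] (O : {set 'I_N}) :
  exists a, forall p, O = jorb s x p ->
    (x ^+ (#|O| %/ d))%g p = (s ^+ a)%g p by exists a => p; apply: aP.
have [p0 /eqP->|noO] := pickP (fun p => O == jorb s x p); last first.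
  (* Dummy value for sets that are not joint orbits. *)
  by exists 0 => p /eqP; rewrite noO.
have /eqP/eq_blkP[a ap0] : blk p0 = blk ((x ^+ (#|jorb s x p0| %/ d))%g p0).
  by rewrite blk_centX card_jorb mulnK ?d_gt0 // permX iter_porbit.
(* The exponent found at [p0] serves the whole orbit, because all powers of [s] and [x] commute. *)
exists a => p e; have := jorb_refl s x p.
rewrite -e => /(jorbP _ _ sx)[i [j ->]].
set m := _ %/ _ in ap0 *.
have permXC (t : {perm 'I_N}) k l q :
    (t ^+ k)%g ((t ^+ l)%g q) = (t ^+ l)%g ((t ^+ k)%g q).
  by rewrite -!permM -!expgD addnC.
rewrite permXC (cent_piX _ _ (groupX m xC)) ap0 permXC.
by rewrite -(cent_piX a _ (groupX j xC)).
Qed.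

Lemma sum_jorbs : \sum_(O in jorbs s x) #|O| %/ d = n.
Proof.
apply/eqP; rewrite -(eqn_pmul2r d_gt0) big_distrl /=.
have <- : #|[set: 'I_N]| = n * d by rewrite cardsT card_ord mulnC.
rewrite (card_partition (jorbs_partition s x)).
apply/eqP/eq_bigr => _ /imsetP[p _ ->].
by rewrite card_jorb mulnK ?d_gt0.
Qed.

End Centralizer.

(** * Values of the linear character on the centralizer *)

Variables (rho : 'CF('C[s]%G)) (z : algC) (b : bool).
Hypothesis rho_lin : rho \is a linear_char.
Hypothesis rhoA : forall j, j < n -> rho (cycA r n j) = z.
Hypothesis rhoB : forall i, i.+1 < n -> rho (swapB r n i) = ((-1) ^+ b)%R.

Lemma rho_prod_cycA (a : 'I_n -> nat) :
  rho (\prod_(j < n) cycA r n j ^+ a j)%g = (z ^+ \sum_(j < n) a j)%R.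
Proof.
rewrite (lin_char_prod rho_lin) => [|j _]; last by rewrite groupX ?cycA_cent.
rewrite expr_sum; apply: eq_bigr => j _.
by rewrite (lin_charX rho_lin) ?cycA_cent // rhoA.
Qed.

Lemma rho_pi : rho s = (z ^+ n)%R.
Proof.
rewrite -[n in RHS]card_ord -sum1_card -rho_prod_cycA; congr (rho _).
by apply/permP => p; rewrite prod_cycAE.
Qed.

Lemma rho_liftB_tperm (i j : 'I_n) :
  i != j -> rho (liftB (tperm i j)) = ((-1) ^+ b)%R.
Proof.
move=> ij; have n_gt1 : 1 < n.
  move: ij; rewrite -val_eqE /=.
  by case: (n) i j => [[]//|[|m]] // [[|?] ?] [[|?] ?].
(* [t] sends [i0] to [i] and [i1] to [j], so it conjugates the first adjacent transposition, whose
   value is given, to [tperm i j]. *)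
pose i0 := Ordinal (ltnW n_gt1); pose i1 := Ordinal n_gt1.
pose u := tperm i0 i; pose t := (u * tperm (u i1) j)%g.
have ti0 : t i0 = i.
  rewrite permM tpermL tpermD // 1?eq_sym //.
  by rewrite -[X in X != _](tpermL i0 i) (inj_eq perm_inj).
have ti1 : t i1 = j by rewrite permM tpermL.
have <- : (tperm i0 i1 ^ t)%g = tperm i j by rewrite tpermJ ti0 ti1.
by rewrite liftBJ cfunJ ?liftB_cent // liftB_swap // rhoB.
Qed.

Lemma rho_liftB (sg : 'S_n) : rho (liftB sg) = ((-1) ^+ (b && odd_perm sg))%R.
Proof.
have [ts -> dts] := prod_tpermP sg; rewrite odd_perm_prod //.
elim: ts dts => [_|[i j] ts IHts /= /andP[ij dts]].
  by rewrite big_nil liftB1 lin_char1 ?andbF.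
rewrite big_cons liftBM (lin_charM rho_lin) ?liftB_cent // IHts //.
rewrite rho_liftB_tperm //; case: (b); case: (odd _); rewrite ?mulr1 ?mul1r //.
by rewrite /= expr1 mulrNN mulr1.
Qed.

Section CharacterValue.

Variables (x : {perm 'I_N}) (sg : 'S_n).
Hypothesis xC : x \in 'C[s]%g.
Hypothesis blkx : forall p, blk (x p) = sg (blk p).

(** Joint orbits correspond to cycles of [sg]. Going once around a cycle, the exponents at the base
    points add up to the return exponent modulo [d]. The sign comes from the parity of [sg], which
    is that of [n] plus its number of cycles. *)
Lemma rho_cent (a : {set 'I_N} -> nat) : (z ^+ d = 1)%R ->
    (forall p, (x ^+ (#|jorb s x p| %/ d))%g p = (s ^+ a (jorb s x p))%g p) ->
  rho x = ((\prod_(O in jorbs s x) z ^+ a O) *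
           (-1) ^+ (b && (odd n (+) odd #|jorbs s x|)))%R.
Proof.
move=> zd aP.
have /fin_all_exists[al alE] j :
    exists i, x (base j) = (s ^+ i)%g (base (sg j)).
  by apply/eq_blkP; rewrite blkx !blk_base.
have xX k j : (x ^+ k)%g (base j) =
    (s ^+ (\sum_(i <- traject sg j k) al i))%g (base (iter k sg j)).
  elim: k => [|k IHk]; first by rewrite big_nil !perm1.
  rewrite expgSr permM IHk cent_piX // alE trajectSr big_rcons /=.
  by rewrite -permM -expgD addnC.
rewrite [in LHS](cent_decomp xC alE) (lin_charM rho_lin) ?liftB_cent //;
  last first.
  by rewrite group_prod // => j _; rewrite groupX ?cycA_cent.
rewrite rho_prod_cycA rho_liftB (jorbsE xC blkx) card_imset;
  last exact: blk_preim_inj.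
rewrite /odd_perm card_ord; congr (_ * _)%R.
rewrite big_imset /=; last by move=> ? ? _ _; apply: blk_preim_inj.
have porP : partition (porbits sg) [set: 'I_n].
  have -> : porbits sg = orbit 'P <[sg]>%g @: [set: 'I_n].
    by apply/setP => C; apply/imsetP/imsetP => -[j _ ->]; exists j;
      rewrite ?inE ?porbitE.
  by apply: orbit_partition; apply/actsP => g _ j; rewrite !inE.
rewrite expr_sum (eq_bigl (fun j => j \in [set: 'I_n])) => [|j];
  last by rewrite inE.
rewrite (set_partition_big _ porP); apply: eq_bigr => _ /imsetP[j _ ->].
rewrite -expr_sum -(expr_mod _ zd) -[RHS](expr_mod _ zd); congr (_ ^+ _)%R.
have := aP (base j).
rewrite (jorb_preim xC blkx) blk_base card_blk_preim mulnK ?d_gt0 //.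
rewrite xX iter_porbit => /eqP; rewrite eq_piX => /eqP <-; congr (_ %% _).
rewrite big_uniq ?uniq_traject_porbit //; apply: eq_bigl => i.
by rewrite porbit_traject.
Qed.

End CharacterValue.

Lemma rho_conj_pair e k : e \in [:: 2; 4] -> e %| d -> (z ^+ e = 1)%R ->
    (s ^ k)%g \in 'C[s]%g ->
  (rho (s ^ k)%g * rho (s ^ k^-1)%g = rho s ^+ 2)%R.
Proof.
move=> e24 ed ze xC; set x := (s ^ k)%g in xC *; set y := (s ^ k^-1)%g.
have zd : (z ^+ d = 1)%R by rewrite -(divnK ed) mulnC exprM ze expr1n.
have yk : (y ^ k)%g = s by rewrite /y conjgKV.
clearbody y.
have yC : y \in 'C[s]%g.
  apply/cent1P; apply: (conjg_inj k); rewrite !conjMg yk.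
  exact/esym/cent1P.
have sy : commute s y by exact/esym/cent1P.
have [sgx blkx] := cent_blk xC; have [sgy blky] := cent_blk yC.
have [a aP] := return_exists xC blkx; have [c cP] := return_exists yC blky.
rewrite (rho_cent xC blkx zd aP) (rho_cent yC blky zd cP).
(* Conjugation by [k] takes the pair [(s, y)] to [(x, s)]. *)
have jorbk p : jorb s x (k p) = [set k q | q in jorb s y p].
  by rewrite jorbC -[s in jorb x s]yk jorbJ.
have -> : jorbs s x = [set [set k q | q in O] | O : {set 'I_N} in jorbs s y].
  by rewrite -jorbsJ // yk /jorbs jorbC.
have k_inj : injective (fun O : {set 'I_N} => [set k q | q in O]).
  exact/imset_inj/perm_inj.
rewrite card_imset // big_imset => [|? ? _ _ /k_inj //] /=.
(* There are equally many joint orbits on both sides, so the two signs cancel. *)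
rewrite mulrACA -big_split /= -signr_addb addbb expr0 mulr1.
rewrite rho_pi -exprM -[in RHS](sum_jorbs yC blky) big_distrl /= expr_sum.
apply: eq_bigr => _ /imsetP[p _ ->].
rewrite -jorbk; set A := a _; set C := c _; set m := _ %/ _.
have card_k : #|jorb s x (k p)| = #|jorb s y p|.
  by rewrite jorbk card_imset //; apply: perm_inj.
have xm : (x ^+ m)%g (k p) = (s ^+ A)%g (k p) by rewrite -aP card_k.
have sm : (s ^+ m)%g (k p) = (x ^+ C)%g (k p).
  by rewrite -yk -!conjXg !permJ cP.
(* Pulled back through [k], [xm] says that [y ^+ A] and [s ^+ m] agree at [p]. *)
have /dvdnP[al A_def] : m %| A.
  apply: (return_dvd yC blky (f := m)); apply: (@perm_inj _ k).
  rewrite -[k ((y ^+ A)%g p)]permJ -[k ((s ^+ m)%g p)]permJ.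
  by rewrite !conjXg yk -/x xm.
have /dvdnP[be C_def] : m %| C.
  by rewrite /m -card_k; apply: (return_dvd xC blkx (f := m)).
have xmX i : (x ^+ (m * i))%g (k p) = (s ^+ (A * i))%g (k p).
  elim: i => [|i IHi]; first by rewrite !muln0.
  by rewrite !mulnS expgD permM xm cent_piX ?groupX // IHi -permM -expgD addnC.
(* At [k p], [s ^+ m] is [x ^+ (m * be)], which is [s ^+ (A * be)]; compare exponents modulo [d],
   then modulo its divisor [e]. *)
have mod_e : m = m * (al * be) %[mod e].
  have : (s ^+ m)%g (k p) == (s ^+ (A * be))%g (k p).
    by rewrite sm C_def [be * m]mulnC xmX.
  rewrite eq_piX => /eqP /(congr1 (modn^~ e)).
  by rewrite !modn_dvdm // A_def [al * m]mulnC mulnA.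
rewrite -exprD -[LHS](expr_mod _ ze) A_def C_def.
by rewrite (mul_inverse_mod e24 mod_e) expr_mod.
Qed.

End BlockPermutations.

(** * From conjugates of [s] to the negativity of the braiding *)

Lemma chi_mu_negative r n (b : bool) c e (rho : 'CF('C[pi_perm r n]%G)) :
    0 < r -> rho \is a linear_char -> rho (pi_perm r n) = (-1)%R ->
    is_chi_mu rho c b -> e \in [:: 2; 4] -> e %| r.*2 -> r.*2 %| c * e ->
  negative_braiding (pi_perm r n) rho.
Proof.
move=> r0 rho_lin rho_pi1 [rhoA rhoB] e24 ed dce t u g h -> -> tu.
have conjE (v w q : {perm 'I_(r.*2 * n)}) :
    (w * v ^ q * w^-1)%g = (v ^ (q * w^-1))%g.
  by rewrite conjgM /conjg invgK !mulgA.
rewrite !conjE !mulgV conjg1; split=> //.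
have -> : (h * g^-1 = (g * h^-1)^-1)%g by rewrite invMg invgK.
(* [omega r] to the power [2r] is the square of -1, and [2r] divides [c * e]. *)
have ze : ((omega r ^+ c) ^+ e = 1)%R.
  have /dvdnP[i ci] := dce; rewrite -exprM ci mulnC -muln2 2!exprM rootCK //.
  by rewrite sqrrN !expr1n.
rewrite (rho_conj_pair r0 rho_lin rhoA rhoB e24 ed ze);
  first by rewrite rho_pi1 sqrrN expr1n.
(* Conjugating by [h] turns the claim into the commutation of [s ^ g] and [s ^ h]. *)
by rewrite -(memJ_conjg _ h) -conjgM mulgKV -cent1J; apply/cent1P.
Qed.

(* b = false : mu = epsilon (trivial),  b = true : mu = sgn *)
Theorem theorem2p16 (r n : nat) (hr : 2 <= r) (hn : 2 <= n) (b : bool)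
  (rho : 'CF('C[pi_perm r n]%G)) :
  rho \is a linear_char ->
  rho (pi_perm r n) = (-1)%R ->
  (odd r -> is_chi_mu rho r b -> negative_braiding (pi_perm r n) rho) /\
  (~~ odd r -> forall c : nat, c \in [:: r./2; r; 3 * r./2] ->
     is_chi_mu rho c b -> negative_braiding (pi_perm r n) rho).
Proof.
move=> rho_lin rho_pi1; have r0 : 0 < r by apply: ltnW.
split=> [_ chi|r_even c c_in chi].
  apply: (chi_mu_negative r0 rho_lin rho_pi1 chi (e := 2)) => //.
    by rewrite -muln2 dvdn_mull.
  by rewrite -muln2.
have r2 : r = r./2 * 2 by rewrite muln2 even_halfK.
have d4 : r.*2 = r./2 * 4 by rewrite -muln2 {1}r2 -mulnA.
(* Here [2r] is four times [r./2], and each admissible [c] is a multiple of [r./2]. *)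
apply: (chi_mu_negative r0 rho_lin rho_pi1 chi (e := 4)) => //.
  by rewrite d4 dvdn_mull.
rewrite d4 dvdn_mul //.
move: c_in; rewrite !inE => /or3P[] /eqP->; rewrite ?dvdn_mull //.
by rewrite {2}r2 dvdn_mulr.
Qed.
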